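(* For combinatorial network auctions with single-minded bidders, the NSA (Network Single-minded Auction) mechanism is individually rational, strategyproof and weakly budget balanced.
   Context: Model. A seller $s$ has a set $\mathcal K$ of heterogeneous items. The seller and a finite set of bidders are the nodes of a social network. Each bidder $i$ is single-minded: there is a publicly known bundle $S_i^\ast\subseteq\mathcal K$ such that she values $S_i^\ast$ at $v_i\ge0$ and every other bundle at $0$. Her private type is $\theta_i=(v_i,r_i)$, with $r_i$ her set of neighbors; she reports $(v_i',r_i')$ with $v_i'\ge0$, $r_i'\subseteq r_i$ (the neighbors she invites). Reports induce a digraph $G$ in which $s$ points to all her neighbors and each bidder $i$ points to the members of $r_i'$; only bidders reachable from $s$ participate, and this set is denoted $N$. $f_i\in\{0,1\}$ indicates whether $i$ receives $S_i^\ast$. Payments are $p_i\in\mathbb R$, utility is $u_i=f_iv_i-p_i$. Individually rational: $u_i((v_i,r_i'),\theta'_{-i})\ge0$ for all $i$, $v_i$, $r_i'\subseteq r_i$, $\theta'_{-i}$. Strategyproof: $u_i((v_i,r_i),\theta'_{-i})\ge u_i((v_i',r_i'),\theta'_{-i})$ for all $i$, all true types $(v_i,r_i)$, all $v_i'\ge0$, $r_i'\subseteq r_i$, all $\theta'_{-i}$. Weakly budget balanced: $\sum_ip_i(\theta')\ge0$ for all report profiles $\theta'$. Bidder $i$ invitationally dominates $j$ if all paths from $s$ to $j$ in $G$ contain $i$; $T_i$ is the set of bidders invitationally dominated by $i$, including $i$. NSA mechanism. Allocation: let $\mathcal O$ be the breadth-first-search order of $N$ from $s$ in $G$ (increasing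 distance, ties broken by a fixed order), and $W=\emptyset$. Process bidders $i$ in the order $\mathcal O$: let $N_{-T_i}=(N\setminus T_i)\cup\{i\}$; if $i=\arg\max_{j\in N_{-T_i}}\frac{v_j}{\sqrt{|S_j^\ast|}}$ (reported bids) and $S_i^\ast\cap\bigcup_{j\in W}S_j^\ast=\emptyset$, add $i$ to $W$. Bidder $i$ receives $S_i^\ast$ if and only if $i\in W$. Payment: $p_i=v_i^\ast(r_i)$ if $f_i=1$ and $p_i=0$ if $f_i=0$, where $r_i$ is the reported invitation set and $v_i^\ast(r)=\inf\{x\ge0: f_i((x,r),\theta'_{-i})=1\}$ is the critical winning bid. *)

(* Defs.v *)
From mathcomp Require Import all_boot all_order all_algebra.
From mathcomp Require Import boolp classical_sets reals.

Set Implicit Arguments.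
Unset Strict Implicit.
Unset Printing Implicit Defensive.

Import Order.TTheory GRing.Theory Num.Theory.
Local Open Scope ring_scope.

(* [T] is the set of bidders; the seller is the extra node [None]. *)
Definition node (T : finType) : finType := option T.

Record report (R : realType) (T : finType) :=
  Report { bid : R; invited : {set node T} }.

Definition profile (R : realType) (T : finType) := T -> report R T.

Definition valid_profile (R : realType) (T : finType) (th : profile R T) :=
  forall i, 0 <= bid (th i).

(* The profile in which [i] reports [t] and the others report as in [th]; the
   value [th i] is irrelevant, so [th] stands for a profile of the others. *)
Definition deviate (R : realType) (T : finType) (th : profile R T)
    (i : T) (t : report R T) : profile R T :=
  fun j => if j == i then t else th j.

Definition total_order (T : eqType) (le : rel T) :=
  [/\ total le, antisymmetric le & transitive le].

(* [alloc th i] tells whether [i] receives her desired bundle. *)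
Record mechanism (R : realType) (T : finType) := Mechanism {
  alloc : profile R T -> T -> bool;
  payment : profile R T -> T -> R
}.

Section Properties.
Variables (R : realType) (T : finType) (M : mechanism R T).

(* Utility of bidder [i] with true value [v] when the reports are [th]. *)
Definition utility (v : R) (i : T) (th : profile R T) : R :=
  (alloc M th i)%:R * v - payment M th i.

Definition individually_rational :=
  forall (i : T) (v : R) (r r' : {set node T}) (th : profile R T),
    0 <= v -> r' \subset r -> valid_profile th ->
    0 <= utility v i (deviate th i (Report v r')).

Definition strategyproof :=
  forall (i : T) (v v' : R) (r r' : {set node T}) (th : profile R T),
    0 <= v -> 0 <= v' -> r' \subset r -> valid_profile th ->
    utility v i (deviate th i (Report v' r'))
      <= utility v i (deviate th i (Report v r)).

Definition weakly_budget_balanced :=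
  forall th : profile R T, valid_profile th -> 0 <= \sum_(i : T) payment M th i.

End Properties.

Section NSA.
Variables (R : realType) (K T : finType).
Variable S : T -> {set K}.         (* desired bundles *)
Variable seller_nbrs : {set T}.
Variables (le_bfs le_max : rel T). (* tie-breaking orders *)

Section Graph.
Variable th : profile R T.

Definition edge : rel (node T) := fun x y =>
  match x with
  | Some i => y \in invited (th i)
  | None => if y is Some j then j \in seller_nbrs else false
  end.

Definition participants : {set T} := [set i | connect edge None (Some i)].

(* Length of a shortest path from the seller to [i]: a reachable node has a
   path with fewer than [#|node T|] edges. *)
Definition distance (i : T) : nat :=
  find (fun n => [exists p : n.-tuple (node T),
                    path edge None p && (last None p == Some i)])
       (iota 0 #|node T|).

Definition bfs_le : rel T := fun i j =>
  (distance i < distance j)%N || (distance i == distance j) && le_bfs i j.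

Definition bfs_order : seq T := sort bfs_le (enum participants).

Definition dominates (i j : T) : Prop :=
  forall p : seq (node T),
    path edge None p -> last None p = Some j -> Some i \in p.

Definition dominated (i : T) : {set T} := [set j | `[< dominates i j >]].

Definition competitors (i : T) : {set T} :=
  (participants :\: dominated i) :|: [set i].

(* For an empty bundle this is 0, since [x / 0 = 0]. *)
Definition score (j : T) : R := bid (th j) / Num.sqrt #|S j|%:R.

(* The maximizer is unique, ties being broken by [le_max]. If every maximizer
   were accepted, raising a winning bid could make it lose. *)
Definition is_argmax (i : T) (A : {set T}) : bool :=
  (i \in A) && [forall j in A, (score j < score i)
                               || (score j == score i) && le_max i j].

Definition nsa_winners : {set T} :=
  foldl (fun (W : {set T}) i =>
           if is_argmax i (competitors i)
              && [disjoint S i & \bigcup_(j in W) S j]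
           then i |: W else W)
        finset.set0 bfs_order.

Definition nsa_alloc (i : T) : bool := i \in nsa_winners.

End Graph.

Definition critical_bid (th : profile R T) (i : T) (r : {set node T}) : R :=
  inf [set x : R | 0 <= x /\ nsa_alloc (deviate th i (Report x r)) i]%classic.

Definition nsa_payment (th : profile R T) (i : T) : R :=
  if nsa_alloc th i then critical_bid th i (invited (th i)) else 0.

Definition NSA : mechanism R T := Mechanism nsa_alloc nsa_payment.

End NSA.

(* Main.v *)
(* Whether bidder i wins depends only on the bidders that precede her in the
   breadth-first order. A path to one of them that is no longer than the distance
   to i avoids i, so that prefix does not depend on whom i invites; nor do her own
   competitors, who are reached by paths avoiding i. Hence the set of winning
   bids of i is upward closed and independent of her invitations, and the critical
   bid is a threshold price that she cannot manipulate. *)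

Require Import Defs.
From mathcomp Require Import all_boot all_order all_algebra.
From mathcomp Require Import boolp classical_sets reals.

Set Implicit Arguments.
Unset Strict Implicit.
Unset Printing Implicit Defensive.

Import Order.TTheory GRing.Theory Num.Theory.

(** * Cutting paths and unfolding greedy folds *)

(** Cut [p] at its first visit to [y]: the prefix uses no edge out of [y], so it survives any change
    of those edges. The bound improves by one when [p] ends elsewhere, since something then follows
    [y]. *)
Lemma path_first_visit (U : eqType) (e : rel U) (x y : U) (p : seq U) :
  path e x p -> y \in p ->
  exists q, [/\ path e x (rcons q y), y \notin q, {subset rcons q y <= p}
              & (size q < size p)%N /\ (last x p != y -> (size q).+1 < size p)%N].
Proof.
move=> ep yp; have yp' : has (pred1 y) p by rewrite has_pred1.
case/split_find: yp' ep {yp} => z q1 q2 /= /eqP -> nq.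
rewrite cat_path => /andP[eq1 _]; exists q1; split => //.
- by rewrite -has_pred1.
- by move=> w wq; rewrite mem_cat wq.
- rewrite size_cat size_rcons last_cat last_rcons; split; first by rewrite leq_addr.
  by case: q2 => [|w q2] /=; rewrite ?eqxx // addnS ltnS leq_addr.
Qed.

Section GreedyFold.
Variables (T : finType) (c : T -> {set T} -> bool).

Let f (W : {set T}) j := if c j W then j |: W else W.

Lemma in_foldl_addset_notin (W : {set T}) (s : seq T) i :
  i \notin s -> (i \in foldl f W s) = (i \in W).
Proof.
elim: s W => //= j s IH W; rewrite inE negb_or => /andP[nij nis].
by rewrite IH // /f; case: (c j W) => //; rewrite !inE (negPf nij).
Qed.

(** Only the step that processes [i] can add [i], and no step removes anything. *)
Lemma in_foldl_addset (s : seq T) i : uniq s -> i \in s ->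
  (i \in foldl f finset.set0 s) = c i (foldl f finset.set0 (take (index i s) s)).
Proof.
move=> us si; have ni : i \notin take (index i s) s by rewrite in_take // ltnn.
rewrite -{1}(cat_take_drop (index i s) s) foldl_cat drop_index //=.
have /= := us; rewrite -{1}(cat_take_drop (index i s) s) drop_index // cat_uniq /=.
case/and4P=> _ _ ni2 _; rewrite in_foldl_addset_notin // {1}/f.
case: (c i _); first by rewrite finset.setU11.
by rewrite in_foldl_addset_notin // finset.in_set0.
Qed.

End GreedyFold.

Lemma eq_in_foldl (A : Type) (B : eqType) (f g : A -> B -> A) (s : seq B) a :
  (forall b z, b \in s -> f z b = g z b) -> foldl f a s = foldl g a s.
Proof.
elim: s a => //= b s IH a fg; rewrite fg ?mem_head //.
by apply: IH => c z cs; apply: fg; rewrite inE cs orbT.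
Qed.

Section Nsa.
Local Open Scope ring_scope.
Variables (R : realType) (K T : finType) (S : T -> {set K}).
Variables (seller_nbrs : {set T}) (le_bfs le_max : rel T).
Hypothesis total_bfs : total_order le_bfs.
Hypothesis total_max : total_order le_max.

Local Notation edge := (edge seller_nbrs).
Local Notation participants := (participants seller_nbrs).
Local Notation distance := (distance seller_nbrs).
Local Notation bfs_le := (bfs_le seller_nbrs le_bfs).
Local Notation bfs_order := (bfs_order seller_nbrs le_bfs).
Local Notation competitors := (competitors seller_nbrs).
Local Notation is_argmax := (is_argmax S le_max).
Local Notation alloc := (nsa_alloc S seller_nbrs le_bfs le_max).

Implicit Types (th : profile R T) (i j k : T).

(** * Shortest paths from the seller *)

Lemma distance_le_size th i p :
  path (edge th) None p -> last None p = Some i -> (distance th i <= size p)%N.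
Proof.
(* A path longer than the searched range is covered by [find] never exceeding the length of its
   list. *)
move=> ep lp; have [card_p|p_card] := leqP #|node T| (size p).
  by apply: leq_trans card_p; rewrite -[X in (_ <= X)%N](size_iota 0) find_size.
rewrite leqNgt; apply/negP => /(before_find 0%N)/negbT/negP; apply.
rewrite nth_iota // add0n /=; apply/existsP; exists (in_tuple p).
by rewrite ep lp /=.
Qed.

Lemma shortest_path th i : i \in participants th ->
  exists p, [/\ path (edge th) None p, last None p = Some i & size p = distance th i].
Proof.
rewrite inE => /connectP[p0 ep0 lp0].
(* Removing loops leaves distinct nodes, all different from the seller, so the length falls in the
   range that [distance] searches. *)
move: lp0; case/shortenP: ep0 => p ep up _ lp.
have p_card : (size p < #|node T|)%N by have /card_uniqP /= <- := up; apply: max_card.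
have hasp : has (fun n => [exists p : n.-tuple (node T),
                    path (edge th) None p && (last None p == Some i)])
       (iota 0 #|node T|).
  apply/hasP; exists (size p); first by rewrite mem_iota.
  by apply/existsP; exists (in_tuple p); rewrite ep -lp /=.
have := nth_find 0%N hasp; move: hasp; rewrite has_find size_iota => find_lt.
rewrite nth_iota // add0n.
by case/existsP=> q /andP[eq /eqP lq]; exists q; rewrite size_tuple.
Qed.

Lemma participantsP th i :
  reflect (exists p, path (edge th) None p /\ last None p = Some i)
          (i \in participants th).
Proof.
rewrite inE; apply: (iffP connectP) => -[p].
  by move=> ep lp; exists p.
by case=> ep lp; exists p.
Qed.

(** Trades the quantification over all paths in [dominates] for one witness path, which can be
    carried from one profile to another. *)
Lemma competitorsP th j k :
  reflect (k = j \/ exists p, [/\ path (edge th) None p, last None p = Some k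
                                & Some j \notin p])
          (k \in competitors th j).
Proof.
rewrite !inE; apply: (iffP orP).
  case=> [/andP[/asboolPn ndom _]|/eqP]; last by left.
  right; apply: contra_notP ndom => nex p ep lp.
  by apply: contra_notT nex => jp; exists p.
case=> [->|[p [ep lp jp]]]; first by right.
left; apply/andP; split; last by apply/connectP; exists p.
by apply/asboolPn => /(_ p ep lp); apply/negP.
Qed.

(** * The breadth-first order and its prefixes *)

Lemma bfs_le_total th : total (bfs_le th).
Proof.
case: total_bfs => tot _ _ i j; rewrite /bfs_le eq_sym.
by case: ltngtP => //= _; apply: tot.
Qed.

Lemma bfs_le_trans th : transitive (bfs_le th).
Proof.
case: total_bfs => _ _ tr j i k; rewrite /bfs_le.
case/orP=> [ij|/andP[/eqP-> ij]] /orP[jk|/andP[/eqP<- jk]].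
- by rewrite (ltn_trans ij jk).
- by rewrite ij.
- by rewrite jk.
- by rewrite eqxx (tr _ _ _ ij jk) orbT.
Qed.

Lemma bfs_le_anti th : antisymmetric (bfs_le th).
Proof.
case: total_bfs => _ anti _ i j; rewrite /bfs_le eq_sym.
by case: ltngtP => //= _; apply: anti.
Qed.

Lemma mem_bfs_order th i : (i \in bfs_order th) = (i \in participants th).
Proof. by rewrite mem_sort mem_enum. Qed.

Lemma bfs_order_uniq th : uniq (bfs_order th).
Proof. by rewrite sort_uniq enum_uniq. Qed.

Definition before th i := take (index i (bfs_order th)) (bfs_order th).

Lemma mem_before th i j : i \in participants th ->
  (j \in before th i) = [&& j \in participants th, bfs_le th j i & j != i].
Proof.
rewrite -!mem_bfs_order => si.
have ss : sorted (bfs_le th) (bfs_order th).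
  by apply: sort_sorted; apply: bfs_le_total.
have lt_le := sorted_ltn_index (@bfs_le_trans th) ss.
rewrite /before; have [sj|nsj] /= := boolP (j \in bfs_order th); last first.
  by apply: contraNF nsj; apply: mem_take.
rewrite in_take //; apply/idP/andP => [ji|[le_ji ne_ji]].
  by split; [apply: lt_le | apply: contraTneq ji => ->; rewrite ltnn].
rewrite ltnNge; apply: contra ne_ji; rewrite leq_eqVlt.
case/orP=> [/eqP eq_ij|lt_ij].
  by rewrite -(nth_index i sj) -eq_ij nth_index.
by apply/eqP/(@bfs_le_anti th); rewrite le_ji lt_le.
Qed.

Lemma before_sorted th i : sorted (bfs_le th) (before th i).
Proof.
rewrite /before; apply: take_sorted; apply: sort_sorted.
exact: bfs_le_total.
Qed.

Lemma before_uniq th i : uniq (before th i).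
Proof. by rewrite take_uniq // bfs_order_uniq. Qed.

Definition greedy_step th (W : {set T}) i : {set T} :=
  if is_argmax th i (competitors th i) && [disjoint S i & \bigcup_(j in W) S j]
  then i |: W else W.

Lemma allocE th i :
  alloc th i = [&& i \in participants th, is_argmax th i (competitors th i)
    & [disjoint S i & \bigcup_(j in foldl (greedy_step th) finset.set0 (before th i)) S j]].
Proof.
rewrite /nsa_alloc /nsa_winners -mem_bfs_order.
have [si|nsi] /= := boolP (i \in bfs_order th).
  rewrite (@in_foldl_addset T (fun i W => is_argmax th i (competitors th i) &&
    [disjoint S i & \bigcup_(j in W) S j])) //.
  exact: bfs_order_uniq.
by rewrite in_foldl_addset_notin // finset.in_set0.
Qed.

(** * Paths and distances under a unilateral deviation *)

(** Symmetric in the two profiles, so an inclusion or inequality proved one way yields an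
    equality. *)
Definition agree_off i th th' := forall j, j != i -> th j = th' j.

Lemma agree_off_sym i th th' : agree_off i th th' -> agree_off i th' th.
Proof. by move=> ag j ji; rewrite ag. Qed.

(** [belast x p] lists the nodes whose outgoing edges are used; [i] may still be the endpoint. *)
Lemma path_agree i th th' x p : agree_off i th th' ->
  Some i \notin belast x p -> path (edge th) x p = path (edge th') x p.
Proof.
move=> ag; elim: p x => //= y p IH x; rewrite inE negb_or => /andP[ix ip].
rewrite IH //; congr (_ && _); case: x ix => //= j; rewrite eq_sym => ij.
by rewrite /Defs.edge ag //; apply: contraNneq ij => ->.
Qed.

Lemma path_agree_rcons i th th' p : agree_off i th th' -> Some i \notin p ->
  path (edge th) None (rcons p (Some i)) -> path (edge th') None (rcons p (Some i)).
Proof.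
by move=> ag ip; rewrite (path_agree ag) // belast_rcons inE.
Qed.

Lemma path_agree_notin i th th' p : agree_off i th th' -> Some i \notin p ->
  path (edge th) None p -> path (edge th') None p.
Proof.
move=> ag ip; rewrite (path_agree ag) //.
by apply: contra ip => /mem_belast; rewrite inE.
Qed.

(** A path to [i], cut at its first visit to [i], uses no invitation made by [i]. *)
Lemma distance_agree_self i th th' : agree_off i th th' -> i \in participants th ->
  i \in participants th' /\ (distance th' i <= distance th i)%N.
Proof.
move=> ag /shortest_path[p [ep lp <-]].
have ip : Some i \in p by have := mem_last None p; rewrite lp inE.
have [q [eq iq _ [lt_q _]]] := path_first_visit ep ip.
have eq' := path_agree_rcons ag iq eq.
split; first by apply/participantsP; exists (rcons q (Some i)); rewrite last_rcons.
by apply: leq_trans lt_q; rewrite -(size_rcons q (Some i)) distance_le_size // last_rcons.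
Qed.

Lemma participant_agree i th th' : agree_off i th th' ->
  i \in participants th -> i \in participants th'.
Proof. by move=> ag /(distance_agree_self ag)[]. Qed.

(** Otherwise, as [p] ends at [j], cutting it at [i] would give a path to [i] shorter than her
    distance. *)
Lemma near_path_notin i j th p : j != i -> path (edge th) None p ->
  last None p = Some j -> (size p <= distance th i)%N -> Some i \notin p.
Proof.
move=> ji ep lp pi; apply/negP => ip.
have [q [eq iq _ [_ lt_q]]] := path_first_visit ep ip.
have /lt_q : last None p != Some i by rewrite lp; apply: contra ji => /eqP[->].
rewrite ltnNge => /negP[]; apply: leq_trans pi _.
by rewrite -(size_rcons q (Some i)) distance_le_size // last_rcons.
Qed.

Lemma distance_agree i j th th' : agree_off i th th' -> j \in participants th ->
  (distance th j <= distance th i)%N ->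
  j \in participants th' /\ (distance th' j <= distance th j)%N.
Proof.
have [->|ji] := eqVneq j i; first by move=> ag /(distance_agree_self ag).
move=> ag /shortest_path[p [ep lp <-]] pi.
have ep' := path_agree_notin ag (near_path_notin ji ep lp pi) ep.
by split; [apply/participantsP; exists p | apply: distance_le_size].
Qed.

Lemma distance_agree_eq i th th' : agree_off i th th' -> i \in participants th ->
  distance th i = distance th' i.
Proof.
move=> ag pi; have ag' := agree_off_sym ag.
have [pi' le1] := distance_agree ag pi (leqnn _).
have [_ le2] := distance_agree ag' pi' (leqnn _).
by apply/eqP; rewrite eqn_leq le1 le2.
Qed.

(** * Invariance of prefixes and competitors *)

Lemma bfs_le_distance th i j : bfs_le th i j -> (distance th i <= distance th j)%N.
Proof. by case/orP=> [/ltnW//|/andP[/eqP-> _]]. Qed.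

Lemma mem_before_agree i j th th' : agree_off i th th' -> i \in participants th ->
  j \in before th i -> distance th j = distance th' j /\ j \in before th' i.
Proof.
move=> ag pi; have ag' := agree_off_sym ag; have pi' := participant_agree ag pi.
have di := distance_agree_eq ag pi.
rewrite !mem_before // => /and3P[pj ji ->].
have dji := bfs_le_distance ji.
have [pj' le1] := distance_agree ag pj dji.
(* The converse bound needs [j] to be no farther than [i] under [th'], which follows from [le1]. *)
have [|_ le2] := distance_agree ag' pj'; first by rewrite -di (leq_trans le1).
have dj : distance th j = distance th' j by apply/eqP; rewrite eqn_leq le1 le2.
by split=> //; rewrite pj' andbT /= /Defs.bfs_le -di -dj.
Qed.

(** Both prefixes have the same members at the same distances, hence are sorted for one
    antisymmetric order. *)
Lemma before_agree i th th' : agree_off i th th' -> i \in participants th ->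
  before th i = before th' i.
Proof.
move=> ag pi; have ag' := agree_off_sym ag; have pi' := participant_agree ag pi.
have sub j := @mem_before_agree i j _ _ ag pi.
have sub' j := @mem_before_agree i j _ _ ag' pi'.
have ss' : sorted (bfs_le th) (before th' i).
  have := before_sorted th' i; apply: (sub_in_sorted _ (allss _)).
  move=> j k /sub'[dj _] /sub'[dk _].
  by rewrite /Defs.bfs_le dj dk.
have := sorted_eq (@bfs_le_trans th) (@bfs_le_anti th) (before_sorted th i) ss'.
apply; apply: uniq_perm; rewrite ?before_uniq // => j.
by apply/idP/idP => [/sub[]|/sub'[]].
Qed.

(** A shortest path to [j] is no longer than the distance to [i], so it avoids [i]. *)
Lemma before_competitor i j th : i \in participants th -> j \in before th i ->
  j \in competitors th i.
Proof.
move=> pi; rewrite mem_before // => /and3P[pj ji ne_ji].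
apply/competitorsP; right.
have [p [ep lp sp]] := shortest_path pj; exists p; split=> //.
by apply: near_path_notin ne_ji ep lp _; rewrite sp bfs_le_distance.
Qed.

Lemma competitors_agree_self i th th' : agree_off i th th' ->
  competitors th i = competitors th' i.
Proof.
suff sub th1 th2 : agree_off i th1 th2 ->
    {subset competitors th1 i <= competitors th2 i}.
  move=> ag; apply/setP => k; apply/idP/idP; apply: sub => //.
  exact: agree_off_sym.
move=> ag k /competitorsP[->|[p [ep lp ip]]]; apply/competitorsP; first by left.
by right; exists p; split=> //; apply: path_agree_notin ag ip ep.
Qed.

(** A path to [i] avoiding [j], cut at its first visit to [i], still avoids [j] and uses no edge out
    of [i]. *)
Lemma competes_agree i j th th' : agree_off i th th' -> j != i ->
  i \in competitors th j -> i \in competitors th' j.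
Proof.
move=> ag ji /competitorsP[/eqP|[p [ep lp jp]]]; first by rewrite eq_sym (negPf ji).
apply/competitorsP; right.
have ip : Some i \in p by have := mem_last None p; rewrite lp inE.
have [q [eq iq qp _]] := path_first_visit ep ip.
exists (rcons q (Some i)); rewrite last_rcons (path_agree_rcons ag) //.
by split=> //; apply: contra jp => /qp.
Qed.

(** A path that avoids [j] cannot meet [i], since its part up to [i] would make [i] a competitor of
    [j]. *)
Lemma competitors_agree i j th th' : agree_off i th th' -> j != i ->
  i \notin competitors th j -> competitors th j = competitors th' j.
Proof.
suff sub th1 th2 : agree_off i th1 th2 -> j != i -> i \notin competitors th1 j ->
    {subset competitors th1 j <= competitors th2 j}.
  move=> ag ji nij; apply/setP => k; apply/idP/idP; apply: sub => //.
    exact: agree_off_sym.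
  by apply: contra nij; apply: competes_agree ji; apply: agree_off_sym.
move=> ag ji nij k /competitorsP[->|[p [ep lp jp]]]; apply/competitorsP; first by left.
right; exists p; split=> //; apply: (path_agree_notin ag _ ep).
apply: contra nij => ip; have [q [eq iq qp _]] := path_first_visit ep ip.
apply/competitorsP; right; exists (rcons q (Some i)); rewrite last_rcons.
by split=> //; apply: contra jp => /qp.
Qed.

(** * Maximizers and monotonicity of the allocation *)

(** Each faces the other, so the scores tie and antisymmetry of [le_max] identifies them. *)
Lemma is_argmax_unique th i j (A B : {set T}) : is_argmax th i A -> is_argmax th j B ->
  j \in A -> i \in B -> i = j.
Proof.
case: total_max => _ anti _.
move=> /andP[_ /forall_inP iA] /andP[_ /forall_inP jB] /iA ji /jB ij.
apply: anti; move: ji ij; rewrite (eq_sym (score S th i)).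
by case: ltgtP => //= _ -> ->.
Qed.

Lemma is_argmax_agree i j th th' : agree_off i th th' -> j != i ->
  i \notin competitors th j ->
  is_argmax th j (competitors th j) = is_argmax th' j (competitors th' j).
Proof.
move=> ag ji nij; rewrite /Defs.is_argmax -(competitors_agree ag ji nij).
congr (_ && _); apply: eq_forallb_in => k kA.
have ki : k != i by apply: contraNneq nij => <-.
by rewrite /score !ag.
Qed.

Lemma is_argmax_raise i (A : {set T}) th th' : agree_off i th th' ->
  bid (th i) <= bid (th' i) -> is_argmax th i A -> is_argmax th' i A.
Proof.
case: total_max => tot _ _.
move=> ag le_bid /andP[iA /forall_inP imax]; apply/andP; split=> //.
apply/forall_inP => j jA; have [->|ji] := eqVneq j i.
  (* Totality of [le_max] provides its reflexivity. *)
  by rewrite eqxx; have := tot i i; rewrite orbb => ->; rewrite orbT.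
have -> : score S th' j = score S th j by rewrite /score ag.
(* Only a weak inequality: an empty bundle scores 0 at every bid. *)
have le_score : score S th i <= score S th' i.
  by rewrite /score ler_wpM2r // invr_ge0 sqrtr_ge0.
case/orP: (imax j jA) => [lt_ji|/andP[/eqP-> mij]].
  by rewrite (lt_le_trans lt_ji).
(* A former tie becomes strict, or remains a tie that [le_max] resolves as before. *)
by rewrite mij andbT orbC -le_eqVlt.
Qed.

(* An earlier bidder facing the competition of [i] cannot be a maximizer, since
   [i] also faces hers; one who does not face it sees the same competition. *)
Lemma alloc_monotone i th th' : agree_off i th th' ->
  bid (th i) <= bid (th' i) -> alloc th i -> alloc th' i.
Proof.
move=> ag le_bid; rewrite !allocE => /and3P[pi imax disj].
have imax' : is_argmax th' i (competitors th' i).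
  by rewrite -(competitors_agree_self ag); apply: is_argmax_raise imax.
rewrite (participant_agree ag pi) imax' /= -(before_agree ag pi).
suff <- : foldl (greedy_step th) finset.set0 (before th i) =
          foldl (greedy_step th') finset.set0 (before th i) by [].
apply: eq_in_foldl => j W jb; rewrite /greedy_step.
have cj := before_competitor pi jb.
have ji : j != i by move: jb; rewrite mem_before // => /and3P[].
suff -> : is_argmax th j (competitors th j) = is_argmax th' j (competitors th' j) by [].
have [ij|nij] := boolP (i \in competitors th j); last exact: (is_argmax_agree ag).
have ij' := competes_agree ag ji ij.
have cj' : j \in competitors th' i by rewrite -(competitors_agree_self ag).
apply/idP/idP => jmax.
  by rewrite (is_argmax_unique imax jmax cj ij) eqxx in ji.
by rewrite (is_argmax_unique imax' jmax cj' ij') eqxx in ji.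
Qed.

(** * Critical bids and incentives *)

Lemma deviate_deviate th i (t t' : report R T) :
  deviate (deviate th i t) i t' = deviate th i t'.
Proof. by apply: funext => j; rewrite /deviate; case: eqP. Qed.

Lemma deviate_self th i (t : report R T) : deviate th i t i = t.
Proof. by rewrite /deviate eqxx. Qed.

(** The case [x = y] says that her invitations do not affect whether [i] wins. *)
Lemma alloc_deviate_monotone th i (x y : R) (r r' : {set node T}) : x <= y ->
  alloc (deviate th i (Report x r')) i -> alloc (deviate th i (Report y r)) i.
Proof.
move=> xy; apply: alloc_monotone; last by rewrite !deviate_self.
by move=> j /negPf ji; rewrite /deviate ji.
Qed.

Local Notation critical := (critical_bid S seller_nbrs le_bfs le_max).

Lemma critical_bid_deviate th i t r : critical (deviate th i t) i r = critical th i r.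
Proof.
by rewrite /critical_bid; congr inf; apply: eq_set => x; rewrite deviate_deviate.
Qed.

Lemma critical_bid_ge0 th i r : 0 <= critical th i r.
Proof.
rewrite /critical_bid; set A := mkset _.
(* With no winning bid, the infimum takes its default value 0. *)
have [->|A0] := eqVneq A set0; first by rewrite inf0.
by apply: lb_le_inf; [apply/set0P | move=> x []].
Qed.

Lemma critical_bid_le th i r x : 0 <= x -> alloc (deviate th i (Report x r)) i ->
  critical th i r <= x.
Proof. by move=> x0 ax; apply: ge_inf; [exists 0 => y [] | split]. Qed.

Lemma critical_bid_invited th i r r' : critical th i r = critical th i r'.
Proof.
by rewrite /critical_bid; congr inf; apply: eq_set => x; apply: propext;
  split=> -[x0 ax]; split=> //; apply: alloc_deviate_monotone ax.
Qed.

Lemma utility_nsa th i (v x : R) (r : {set node T}) :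
  utility (NSA R S seller_nbrs le_bfs le_max) v i (deviate th i (Report x r)) =
  if alloc (deviate th i (Report x r)) i then v - critical th i r else 0.
Proof.
rewrite /utility /= /nsa_payment; case: ifP => _; last by rewrite mul0r subr0.
by rewrite mul1r deviate_self critical_bid_deviate.
Qed.

Lemma utility_truthful_ge0 th i (v : R) (r : {set node T}) : 0 <= v ->
  0 <= utility (NSA R S seller_nbrs le_bfs le_max) v i (deviate th i (Report v r)).
Proof.
move=> v0; rewrite utility_nsa; case: ifP => // av.
by rewrite subr_ge0 critical_bid_le.
Qed.

Lemma nsa_strategyproof : strategyproof (NSA R S seller_nbrs le_bfs le_max).
Proof.
move=> i v v' r r' th v0 v'0 _ _.
have truth0 := utility_truthful_ge0 th i r v0.
rewrite (utility_nsa th i v v'); case: ifP => // av'.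
(* A losing deviation was settled by [truth0]. A winning one brings no gain when the price is at
   least [v]. *)
have [lt_cv|le_vc] := ltP (critical th i r') v; last first.
  by apply: le_trans truth0; rewrite subr_le0.
(* Otherwise some bid [y < v] wins, [v'] witnessing that winning bids exist; so the truthful report
   wins too, at the same price. *)
have [|y [y0 ay] yv] := inf_lt _ lt_cv; first by exists v'.
by rewrite utility_nsa (alloc_deviate_monotone _ (ltW yv) ay) (critical_bid_invited _ _ r r').
Qed.

End Nsa.

Theorem theorem5p2 (R : realType) (K T : finType) (S : T -> {set K})
    (seller_nbrs : {set T}) (le_bfs le_max : rel T)
    (total_bfs : total_order le_bfs) (total_max : total_order le_max) :
  let M := NSA R S seller_nbrs le_bfs le_max in
  individually_rational M /\ strategyproof M /\ weakly_budget_balanced M.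
Proof.
split; last split.
- move=> i v r r' th v0 _ _; exact: utility_truthful_ge0.
- exact: nsa_strategyproof.
- move=> th _; apply: sumr_ge0 => i _ /=; rewrite /nsa_payment.
  by case: ifP => // _; apply: critical_bid_ge0.
Qed.
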